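(* Let $d_I,d_O\in\mathbb N$, $a\in\mathbb R$, $b\in(a,\infty)$, let $\sigma\colon\mathbb R\to\mathbb R$ be locally bounded and measurable, let $\mu\colon\mathcal B([a,b]^{d_I})\to[0,\infty]$ be a finite measure, let $f\colon[a,b]^{d_I}\to\mathbb R^{d_O}$ be measurable, and for architectures $\ell$ with input dimension $d_I$ and output dimension $d_O$ let $D_\ell$, $\mathcal N^{\ell,k,\theta}$ and the (real-valued) risk $\mathcal L_\ell\colon\mathbb R^{D_\ell}\to\mathbb R$ be as defined in the context. Let $\alpha\in\mathbb R$, $\beta\in(\alpha,\infty)$ satisfy $\sigma(x)=\sigma(\alpha)$ for all $x\in(\alpha,\beta)$. Let $L\in\mathbb N$, let $\ell=(\ell_0,\dots,\ell_L)$, $\mathbf l=(\mathbf l_0,\dots,\mathbf l_L)\in\mathbb N^{L+1}$ satisfy $\ell_0=\mathbf l_0=d_I$ and $\ell_L=\mathbf l_L=d_O$, assume $\ell_i\le\mathbf l_i$ for all $i\in\{1,\dots,L-1\}$, and let $\theta\in\mathbb R^{D_\ell}$ be a local minimum point of $\mathcal L_\ell$. Then there exists $\vartheta\in\mathbb R^{D_{\mathbf l}}$ such that (i) $\mathcal N^{\mathbf l,L,\vartheta}(x)=\mathcal N^{\ell,L,\theta}(x)$ for all $x\in\mathbb R^{d_I}$, and (ii) $\vartheta$ is a local minimum point of $\mathcal L_{\mathbf l}$.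
   Context: For $L\in\mathbb N$, $\ell=(\ell_0,\dots,\ell_L)\in\mathbb N^{L+1}$ let $D_\ell=\sum_{k=1}^L\ell_k(\ell_{k-1}+1)$. For $\theta\in\mathbb R^{D_\ell}$ and $k\in\{1,\dots,L\}$ let $W^{\ell,k,\theta}\in\mathbb R^{\ell_k\times\ell_{k-1}}$ and $B^{\ell,k,\theta}\in\mathbb R^{\ell_k}$ have entries $W^{\ell,k,\theta}_{i,j}=\theta_{(i-1)\ell_{k-1}+j+s_k}$ and $B^{\ell,k,\theta}_i=\theta_{\ell_k\ell_{k-1}+i+s_k}$ with $s_k=\sum_{r=1}^{k-1}\ell_r(\ell_{r-1}+1)$. Define $\mathcal N^{\ell,k,\theta}\colon\mathbb R^{\ell_0}\to\mathbb R^{\ell_k}$ by $\mathcal N^{\ell,1,\theta}(x)=B^{\ell,1,\theta}+W^{\ell,1,\theta}x$ and $\mathcal N^{\ell,k+1,\theta}(x)=B^{\ell,k+1,\theta}+W^{\ell,k+1,\theta}\,\sigma(\mathcal N^{\ell,k,\theta}(x))$ for $k\in\{1,\dots,L-1\}$, with $\sigma$ applied componentwise. If $\ell_0=d_I$, $\ell_L=d_O$, then $\mathcal L_\ell(\theta)=\int_{[a,b]^{d_I}}\|\mathcal N^{\ell,L,\theta}(x)-f(x)\|^2\,\mu(dx)$, assumed to be real-valued (finite) for every such $\ell$, where $\|\cdot\|$ is the Euclidean norm. *)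

(* Defs.v *)
From HB Require Import structures.
From mathcomp Require Import all_boot all_order all_algebra.
From mathcomp Require Import all_classical all_reals all_analysis.

Set Implicit Arguments.
Unset Strict Implicit.
Unset Printing Implicit Defensive.

Import Order.TTheory GRing.Theory Num.Theory.
Import numFieldNormedType.Exports.

Local Open Scope classical_set_scope.
Local Open Scope ring_scope.

(* R^n is 'cV[R]_n, with the product topology of the library. *)
Definition borel (R : realType) (n : nat) :=
  g_sigma_algebraType (@open 'cV[R]_n).

Definition euclidean_norm (R : realType) (n : nat) (v : 'cV[R]_n) : R :=
  Num.sqrt (\sum_(i < n) v i 0 ^+ 2).

Definition cube (R : realType) (n : nat) (a b : R) : set 'cV[R]_n :=
  [set x | forall i, a <= x i 0 <= b].

Definition local_minimum (R : realType) (T : topologicalType) (g : T -> R)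
    (t : T) : Prop :=
  \forall u \near t, g t <= g u.

Record architecture (dI dO L : nat) := Architecture {
  widths :> L.+1.-tuple nat ;
  widths_gt0 : forall i : 'I_L.+1, (0 < tnth widths i)%N ;
  widths_first : nth 0%N widths 0 = dI ;
  widths_last : nth 0%N widths L = dO }.

Section Networks.
Variables (R : realType) (dI dO L : nat) (sigma : R -> R).
Variable ell : architecture dI dO L.

Definition width (k : nat) : nat := nth 0%N ell k.

(* The number of parameters of the layers 1, ..., k - 1. *)
Definition offset (k : nat) : nat :=
  \sum_(1 <= r < k) width r * (width r.-1 + 1).

Definition nparams : nat := \sum_(1 <= k < L.+1) width k * (width k.-1 + 1).

(* Indices start at 0; the default value 0 is never used for the parameters
   of the layers 1, ..., L, see weight_index_lt and bias_index_lt below. *)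
Definition param (theta : 'cV[R]_nparams) (n : nat) : R :=
  oapp (fun i : 'I_nparams => theta i 0) 0 (insub n).

Definition weight (theta : 'cV[R]_nparams) (k : nat) :
    'M[R]_(width k, width k.-1) :=
  \matrix_(i, j) param theta (i * width k.-1 + j + offset k).

Definition bias (theta : 'cV[R]_nparams) (k : nat) : 'cV[R]_(width k) :=
  \col_i param theta (width k * width k.-1 + i + offset k).

(* The value at k = 0 is the input itself, to which no activation is applied. *)
Fixpoint realization (theta : 'cV[R]_nparams) (k : nat)
    (x : 'cV[R]_(width 0)) : 'cV[R]_(width k) :=
  match k with
  | 0 => x
  | k'.+1 =>
      let y := realization theta k' x in
      bias theta k'.+1 +
      weight theta k'.+1 *m (if k' == 0%N then y else map_mx sigma y)
  end.

Definition network (theta : 'cV[R]_nparams) (x : 'cV[R]_dI) : 'cV[R]_dO :=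
  castmx (widths_last ell, erefl 1%N)
    (realization theta L (castmx (esym (widths_first ell), erefl 1%N) x)).

(* A finite measure on B([a,b]^dI) and a map f on [a,b]^dI are given by a
   finite Borel measure mu and a map f on R^dI, of which only the restrictions
   to the cube matter. *)
Definition ext_risk (a b : R) (mu : {finite_measure set (borel R dI) -> \bar R})
    (f : 'cV[R]_dI -> 'cV[R]_dO) (theta : 'cV[R]_nparams) : \bar R :=
  (\int[mu]_(x in cube a b)
     (euclidean_norm (network theta x - f x) ^+ 2)%:E)%E.

Definition risk (a b : R) (mu : {finite_measure set (borel R dI) -> \bar R})
    (f : 'cV[R]_dI -> 'cV[R]_dO) (theta : 'cV[R]_nparams) : R :=
  fine (ext_risk a b mu f theta).

Lemma offsetS k : (0 < k)%N ->
  offset k.+1 = (offset k + width k * (width k.-1 + 1))%N.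
Proof. by move=> k0; rewrite /offset big_nat_recr. Qed.

Lemma offset_le_nparams k : (k <= L.+1)%N -> (offset k <= nparams)%N.
Proof.
case: k => [|k] kL; first by rewrite /offset big_geq.
by rewrite /nparams (big_cat_nat (n := k.+1)) //= leq_addr.
Qed.

Lemma bias_index_lt k (i : 'I_(width k)) : (0 < k <= L)%N ->
  (width k * width k.-1 + i + offset k < nparams)%N.
Proof.
case/andP=> k0 kL; apply: leq_trans (@offset_le_nparams k.+1 kL).
by rewrite offsetS // addnC ltn_add2l mulnDr muln1 ltn_add2l.
Qed.

Lemma weight_index_lt k (i : 'I_(width k)) (j : 'I_(width k.-1)) :
  (0 < k <= L)%N -> (i * width k.-1 + j + offset k < nparams)%N.
Proof.
case/andP=> k0 kL; apply: leq_trans (@offset_le_nparams k.+1 kL).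
rewrite offsetS // addnC ltn_add2l mulnDr.
apply: leq_trans (leq_addr _ _); apply: (@leq_trans (i.+1 * width k.-1)).
  by rewrite mulSn addnC ltn_add2r.
by rewrite leq_mul2r ltn_ord orbT.
Qed.

End Networks.

(* Main.v *)
(* The surplus neurons of the wide network get zero incoming and outgoing
   weights and bias (alpha + beta) / 2. For parameters u near the resulting
   vartheta, their preactivations stay in (alpha, beta) uniformly in x in the
   cube, because the activations of each layer are bounded there. Hence they
   emit the constant sigma(alpha), which can be absorbed into the biases of the
   next layer: on the cube, the network of u coincides with a network of the
   narrow architecture whose parameters P(u) depend continuously on u, with
   P(vartheta) = theta. Local minimality therefore pulls back along P. *)

Require Import Defs.
From HB Require Import structures.
From mathcomp Require Import all_boot all_order all_algebra.
From mathcomp Require Import all_classical all_reals all_analysis.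
Import Order.TTheory GRing.Theory Num.Theory.
Import numFieldNormedType.Exports.
Local Open Scope classical_set_scope.
Local Open Scope ring_scope.

Set Implicit Arguments.
Unset Strict Implicit.
Unset Printing Implicit Defensive.

(** * Limits and boundedness along a filter *)

Lemma near_forall_ltn (T : Type) (F : set_system T) (n : nat)
    (P : nat -> T -> Prop) : Filter F ->
  (forall i, (i < n)%N -> \forall t \near F, P i t) ->
  \forall t \near F, forall i, (i < n)%N -> P i t.
Proof.
move=> FF FP.
have : \forall t \near F, forall i : 'I_n, P i t.
  by apply: filter_forall => i; exact: FP.
by apply: filterS => t Pt i ltin; exact: (Pt (Ordinal ltin)).
Qed.

Lemma cvg_mx_coord (R : numFieldType) (T : Type) (F : set_system T) (m n : nat)
    (f : T -> 'M[R]_(m, n)) (A : 'M[R]_(m, n)) : Filter F ->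
  (forall i j, f t i j @[t --> F] --> A i j) -> f t @[t --> F] --> A.
Proof.
move=> FF fA U [P AP sPU].
have : \forall t \near F, forall i j, P i j (f t i j).
  by apply: filter_forall => i; apply: filter_forall => j; exact: (fA i j).
by apply: filterS => t Pt; apply: sPU.
Qed.

Section bounded_near_algebra.
Variables (R : realFieldType) (T : Type) (G : set_system T).
Context {FG : Filter G}.
Implicit Types f g : T -> R.

Lemma bounded_nearP f :
  bounded_near f G <-> exists M : R, \forall t \near G, `|f t| <= M.
Proof.
split=> [/pinfty_ex_gt0[M _ GM]|[M GM]]; first by exists M.
rewrite /bounded_near; near=> M'; apply: filterS GM => t /= /le_trans; apply.
by near: M'; exact: nbhs_pinfty_ge.
Unshelve. all: by end_near. Qed.

Lemma bounded_nearD f g :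
  bounded_near f G -> bounded_near g G -> bounded_near (f \+ g) G.
Proof.
move=> /bounded_nearP[M fM] /bounded_nearP[N gN].
apply/bounded_nearP; exists (M + N).
by apply: filterS2 fM gN => t fM gN; rewrite (le_trans (ler_normD _ _))// lerD.
Qed.

Lemma bounded_nearM f g :
  bounded_near f G -> bounded_near g G -> bounded_near (f \* g) G.
Proof.
move=> /bounded_nearP[M fM] /bounded_nearP[N gN].
apply/bounded_nearP; exists (M * N).
by apply: filterS2 fM gN => t fM gN; rewrite normrM ler_pM.
Qed.

Lemma bounded_near_sum (I : Type) (r : seq I) (f : I -> T -> R) :
  (forall i, bounded_near (f i) G) ->
  bounded_near (fun t => \sum_(i <- r) f i t) G.
Proof.
move=> fb; elim: r => [|i r IHr].
  by apply/bounded_nearP; exists 0; near=> t; rewrite big_nil normr0.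
under eq_fun do rewrite big_cons.
exact: bounded_nearD.
Unshelve. all: by end_near. Qed.

Lemma cvg0M_bounded f g :
  f t @[t --> G] --> (0 : R) -> bounded_near g G ->
  f t * g t @[t --> G] --> (0 : R).
Proof.
move=> f0 /pinfty_ex_gt0[M M0 gM]; apply/cvgr0Pnorm_lt => e e0.
have fM : \forall t \near G, `|f t| < e / M.
  by apply: cvgr0_norm_lt => //; exact: divr_gt0.
apply: (filterS2 _ _ gM fM) => t /= {}gM; rewrite ltr_pdivlMr// normrM.
apply: le_lt_trans.
by rewrite ler_wpM2l.
Qed.

Lemma cvg0_sum_nat (m n : nat) (f : nat -> T -> R) :
  (forall i, (m <= i < n)%N -> f i t @[t --> G] --> (0 : R)) ->
  \sum_(m <= i < n) f i t @[t --> G] --> (0 : R).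
Proof.
(* Repeating the range as a filtering predicate hands [cvg_big] the bounds on [i] that [f0]
   requires. *)
move=> f0; suff : \sum_(m <= i < n | (m <= i < n)%N) f i t @[t --> G] -->
    \sum_(m <= i < n | (m <= i < n)%N) (0 : R).
  by rewrite big1_eq; under eq_fun do rewrite -big_nat.
by apply: cvg_big => //; exact: add_continuous.
Qed.

End bounded_near_algebra.

(** * Locally bounded activations and networks indexed by natural numbers *)

(** Compactness of [[- M, M]], in its near-covering form: each point has a neighbourhood on which
    all large [K] bound [sigma], hence all large [K] work on the whole segment. *)
Lemma locally_bounded_segment (R : realType) (sigma : R -> R) (M : R) :
  [locally [bounded sigma x | x in [set: R]]] ->
  exists K, forall y, `|y| <= M -> `|sigma y| <= K.
Proof.
move=> sb; have /compact_near_coveringP := @segment_compact R (- M) M.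
move=> /(_ R +oo (fun K y => `|sigma y| <= K) _) near_bound.
have [|K [Kreal PK]] := near_bound.
  move=> x _; have := sb x I; rewrite withinET => /pinfty_ex_gt0[K0 _ sK0].
  exists ([set y | `|sigma y| <= K0], [set K | K0 <= K]); first split => //.
    by apply: nbhs_pinfty_ge; exact: num_real.
  by move=> [y K] /= [yK0]; exact: le_trans.
exists (K + 1) => y yM; apply: PK; first by rewrite ltrDl.
by rewrite /= in_itv /= -ler_norml.
Qed.

(* Indexing by [nat] instead of by ordinals makes networks of different widths
   directly comparable. *)
Fixpoint nat_net (R : realType) (w : nat -> nat) (sigma : R -> R)
    (W : nat -> nat -> nat -> R) (B : nat -> nat -> R) (x : nat -> R)
    (k i : nat) : R :=
  if k is k'.+1 then
    B k i + \sum_(0 <= j < w k') W k i j *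
      (let y := nat_net w sigma W B x k' j in if k' == 0%N then y else sigma y)
  else x i.

(** Induction on the layer: the wide sum splits at [w k]. The lower part is the narrow sum by
    induction; in the upper part every activation equals [c], so it is the term added to [B']. *)
Lemma nat_net_merge (R : realType) (w w' : nat -> nat) (sigma : R -> R) (c : R)
    (W' : nat -> nat -> nat -> R) (B' : nat -> nat -> R)
    (W : nat -> nat -> nat -> R) (B : nat -> nat -> R) (x : nat -> R) (L : nat) :
  w 0%N = w' 0%N ->
  (forall k, (k <= L)%N -> (w k <= w' k)%N) ->
  (forall k i j, (0 < k <= L)%N -> (i < w k)%N -> (j < w k.-1)%N ->
    W k i j = W' k i j) ->
  (forall k i, (0 < k <= L)%N -> (i < w k)%N ->
    B k i = B' k i + (\sum_(w k.-1 <= j < w' k.-1) W' k i j) * c) ->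
  (forall k i, (0 < k < L)%N -> (w k <= i < w' k)%N ->
    sigma (nat_net w' sigma W' B' x k i) = c) ->
  forall k i, (k <= L)%N -> (i < w k)%N ->
    nat_net w sigma W B x k i = nat_net w' sigma W' B' x k i.
Proof.
move=> w0 ww' eW eB new; elim=> [|k IHk] i kL iw //=.
rewrite eB //= -addrA; congr (_ + _).
rewrite [in RHS](big_cat_nat (n := w k)) ?ww' ?(ltnW kL)//= addrC; congr (_ + _).
  rewrite !big_nat; apply: eq_bigr => j /andP[_ jw].
  by rewrite eW// IHk// ltnW.
rewrite mulr_suml !big_nat; apply: eq_bigr => j jw.
(* Inputs carry no activation, but none is surplus: [w0] makes the range of [j] empty. *)
case: k => [|k] /= in kL eW eB iw IHk jw *.
  by move: jw; rewrite w0 ltnNge; case: leqP.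
by rewrite -[X in _ = _ * sigma X]/(nat_net w' sigma W' B' x k.+1 j) new.
Qed.

(** Layer by layer: bounded preactivations stay in a segment, on which [sigma] is bounded. With a
    filter on pairs of a parameter and an input, the bound is uniform in the input. *)
Lemma nat_net_bounded (R : realType) (T : Type) (G : set_system T)
    (w : nat -> nat) (sigma : R -> R)
    (W : T -> nat -> nat -> nat -> R) (B : T -> nat -> nat -> R)
    (x : T -> nat -> R) (k i : nat) : Filter G ->
  [locally [bounded sigma x | x in [set: R]]] ->
  (forall k i j, bounded_near (fun t => W t k i j) G) ->
  (forall k i, bounded_near (fun t => B t k i) G) ->
  (forall i, bounded_near (fun t => x t i) G) ->
  bounded_near (fun t => nat_net w sigma (W t) (B t) (x t) k i) G.
Proof.
move=> FG sb Wb Bb xb; elim: k i => [|k IHk] i //=.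
apply: bounded_nearD => //; apply: bounded_near_sum => j.
apply: bounded_nearM => //; case: eqP => // _.
have /bounded_nearP[M gM] := IHk j.
have [K sK] := locally_bounded_segment M sb.
by apply/bounded_nearP; exists K; apply: filterS gM => t /sK.
Qed.

(** The activations of layer [k] are bounded, so incoming weights tending to 0 cancel them and only
    the bias survives in the limit. *)
Lemma nat_net_cvg_bias (R : realType) (T : Type) (G : set_system T)
    (w : nat -> nat) (sigma : R -> R)
    (W : T -> nat -> nat -> nat -> R) (B : T -> nat -> nat -> R)
    (x : T -> nat -> R) (k i : nat) (b : R) : Filter G ->
  [locally [bounded sigma x | x in [set: R]]] ->
  (forall k i j, bounded_near (fun t => W t k i j) G) ->
  (forall k i, bounded_near (fun t => B t k i) G) ->
  (forall i, bounded_near (fun t => x t i) G) ->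
  (forall j, (j < w k)%N -> W t k.+1 i j @[t --> G] --> (0 : R)) ->
  B t k.+1 i @[t --> G] --> b ->
  nat_net w sigma (W t) (B t) (x t) k.+1 i @[t --> G] --> b.
Proof.
move=> FG sb Wb Bb xb W0 Bc; rewrite -[b]addr0; apply: cvgD => //.
apply: cvg0_sum_nat => j /andP[_ jw].
apply: cvg0M_bounded; first exact: W0.
have gb := nat_net_bounded w k j FG sb Wb Bb xb; case: eqP => // _.
have /bounded_nearP[M gM] := gb.
have [K sK] := locally_bounded_segment M sb.
by apply/bounded_nearP; exists K; apply: filterS gM => t /sK.
Qed.

(** * Sequences assembled from consecutive segments *)

(* The sequence whose segment from [s k] to [s k.+1 - 1] is
   [E k 0, E k 1, ...], for [0 < k <= K]. *)
Fixpoint layered (V : Type) (v0 : V) (s : nat -> nat) (E : nat -> nat -> V)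
    (K n : nat) : V :=
  if K is K'.+1 then
    if (s K <= n)%N then E K (n - s K)%N else layered v0 s E K' n
  else v0.

Lemma layered_addn (V : Type) (v0 : V) (s : nat -> nat) (E : nat -> nat -> V)
    (K k r : nat) : {homo s : m n / (m <= n)%N} ->
  (0 < k <= K)%N -> (s k + r < s k.+1)%N ->
  layered v0 s E K (s k + r)%N = E k r.
Proof.
move=> s_mono; elim: K => [|K IHK]; first by case: k.
move=> /= /andP[k0]; rewrite leq_eqVlt => /orP[/eqP-> _|kK rk].
  by rewrite leq_addr addKn.
by rewrite leqNgt (leq_trans rk (s_mono _ _ kK))/= IHK// k0.
Qed.

(** Spares finding the segment that contains [n]: the value is checked on any segment that might. *)
Lemma layered_eq (V : Type) (v0 : V) (s : nat -> nat) (E : nat -> nat -> V)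
    (K n : nat) (v : V) :
  (s 1 <= n < s K.+1)%N ->
  (forall k, (0 < k <= K)%N -> (s k <= n < s k.+1)%N -> E k (n - s k)%N = v) ->
  layered v0 s E K n = v.
Proof.
elim: K => [|K IHK] /andP[n1 nK] Ev /=.
  by move: nK; rewrite ltnNge n1.
case: leqP => [Kn|nK']; first by rewrite Ev ?leqnn ?Kn.
by apply: IHK => [|k /andP[k0 kK]]; [rewrite n1|apply: Ev; rewrite k0 ltnW].
Qed.

Lemma cvg_layered (V : topologicalType) (v0 : V) (s : nat -> nat) (T : Type)
    (F : set_system T) (E : T -> nat -> nat -> V) (E0 : nat -> nat -> V)
    (K n : nat) : Filter F ->
  (forall k r, E t k r @[t --> F] --> E0 k r) ->
  layered v0 s (E t) K n @[t --> F] --> layered v0 s E0 K n.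
Proof.
move=> FF cE; elim: K => [|K IHK] /=; first exact: cvg_cst.
by case: leqP.
Qed.

Definition coord (R : realType) (n : nat) (x : 'cV[R]_n) (k : nat) : R :=
  oapp (fun i : 'I_n => x i 0) 0 (insub k).

Lemma coordE (R : realType) (n : nat) (x : 'cV[R]_n) (i : 'I_n) : coord x i = x i 0.
Proof. by rewrite /coord valK. Qed.

(** * Reading and assembling parameter vectors *)

Section parameters.
Variables (R : realType) (dI dO L : nat) (ell : architecture dI dO L).
Local Notation w := (width ell).
Local Notation s := (offset ell).

Definition nat_weight (theta : 'cV[R]_(nparams ell)) (k i j : nat) : R :=
  param theta (i * w k.-1 + j + s k).

Definition nat_bias (theta : 'cV[R]_(nparams ell)) (k i : nat) : R :=
  param theta (w k * w k.-1 + i + s k).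

(** Inverts the row-major layout of one layer: Euclidean division by [w k.-1] recovers row and
    column of a weight, and the biases follow the weights. *)
Definition layer_entry (W : nat -> nat -> nat -> R) (B : nat -> nat -> R)
    (k r : nat) : R :=
  if (r < w k * w k.-1)%N then W k (r %/ w k.-1)%N (r %% w k.-1)%N
  else B k (r - w k * w k.-1)%N.

Definition mkparams (W : nat -> nat -> nat -> R) (B : nat -> nat -> R) :
    'cV[R]_(nparams ell) :=
  \col_n layered 0 s (layer_entry W B) L n.

Lemma paramE (theta : 'cV[R]_(nparams ell)) (n : 'I_(nparams ell)) :
  param theta n = theta n 0.
Proof. by rewrite /param valK. Qed.

Lemma offset_homo : {homo s : m n / (m <= n)%N}.
Proof.
apply: homo_leq => // [m n p|[|k]]; first exact: leq_trans.
  by rewrite /offset !big_geq.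
by rewrite [leqRHS]offsetS// leq_addr.
Qed.

Lemma param_mkparams W B k r : (0 < k <= L)%N -> (r < w k * (w k.-1 + 1))%N ->
  param (mkparams W B) (r + s k) = layer_entry W B k r.
Proof.
move=> kL rk; have rk' : (s k + r < s k.+1)%N.
  by case/andP: kL => k0 _; rewrite offsetS// ltn_add2l.
have lt_n : (r + s k < nparams ell)%N.
  rewrite addnC (leq_trans rk')//; apply: offset_le_nparams.
  by case/andP: kL.
rewrite (paramE _ (Ordinal lt_n)) mxE /= addnC layered_addn//.
exact: offset_homo.
Qed.

Lemma nat_weight_mkparams W B k i j :
  (0 < k <= L)%N -> (i < w k)%N -> (j < w k.-1)%N ->
  nat_weight (mkparams W B) k i j = W k i j.
Proof.
move=> kL iw jw.
have r_lt : (i * w k.-1 + j < w k * w k.-1)%N.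
  apply: (@leq_trans (i.+1 * w k.-1)); first by rewrite mulSn addnC ltn_add2r.
  by rewrite leq_mul2r iw orbT.
rewrite /nat_weight param_mkparams//; last first.
  by rewrite mulnDr (leq_trans r_lt)// leq_addr.
rewrite /layer_entry r_lt divnMDl ?(leq_ltn_trans _ jw)// divn_small// addn0.
by rewrite modnMDl modn_small.
Qed.

Lemma nat_bias_mkparams W B k i :
  (0 < k <= L)%N -> (i < w k)%N -> nat_bias (mkparams W B) k i = B k i.
Proof.
move=> kL iw; rewrite /nat_bias param_mkparams//.
  by rewrite /layer_entry ltnNge leq_addr/= addKn.
by rewrite mulnDr muln1 ltn_add2l.
Qed.

(** Every coordinate of a parameter vector is a weight or a bias of some layer, so these entries
    determine the vector. *)
Lemma mkparams_eq W B (theta : 'cV[R]_(nparams ell)) :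
  (forall k i j, (0 < k <= L)%N -> (i < w k)%N -> (j < w k.-1)%N ->
    W k i j = nat_weight theta k i j) ->
  (forall k i, (0 < k <= L)%N -> (i < w k)%N -> B k i = nat_bias theta k i) ->
  mkparams W B = theta.
Proof.
move=> eW eB; apply/colP => n; rewrite mxE -paramE.
apply: layered_eq => [|k kL /andP[kn nk]].
  by rewrite {1}/offset big_geq//= ltn_ord.
rewrite -[in RHS](subnK kn); move: (n - s k)%N (subnK kn) nk => r <-.
case/andP: (kL) => k0 _; rewrite offsetS// addnC ltn_add2l => rk.
rewrite /layer_entry; case: ltnP => [r_lt|r_ge].
  have w0 : (0 < w k.-1)%N by move: r_lt; case: (w k.-1) => //; rewrite muln0.
  by rewrite eW ?ltn_mod ?ltn_divLR// /nat_weight -divn_eq addnC.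
rewrite eB//; last by rewrite ltn_subLR//; rewrite mulnDr muln1 in rk.
by rewrite /nat_bias subnKC// addnC.
Qed.

Lemma cvg_mkparams (T : Type) (F : set_system T)
    (W : T -> nat -> nat -> nat -> R) (B : T -> nat -> nat -> R) W0 B0 :
  Filter F ->
  (forall k i j, W t k i j @[t --> F] --> W0 k i j) ->
  (forall k i, B t k i @[t --> F] --> B0 k i) ->
  mkparams (W t) (B t) @[t --> F] --> mkparams W0 B0.
Proof.
move=> FF cW cB; apply: cvg_mx_coord => n j; rewrite mxE.
under eq_fun do rewrite mxE.
by apply: cvg_layered => k r; rewrite /layer_entry; case: ltnP.
Qed.

Lemma param_cvg (theta : 'cV[R]_(nparams ell)) (n : nat) :
  param u n @[u --> theta] --> param theta n.
Proof.
rewrite /param; case: insubP => [i _ _|_] /=.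
  exact: coord_continuous.
exact: (@cst_continuous _ _ (0 : R)).
Qed.

(** The input is compared with an arbitrary sequence [y] so that the cast from ['cV_dI] in [network]
    can be absorbed. *)
Lemma realization_nat_net (sigma : R -> R) (theta : 'cV[R]_(nparams ell))
    (x : 'cV[R]_(w 0)) (y : nat -> R) (k : nat) (i : 'I_(w k)) :
  (forall i : 'I_(w 0), x i 0 = y i) ->
  realization sigma theta k x i 0 =
  nat_net w sigma (nat_weight theta) (nat_bias theta) y k i.
Proof.
move=> xy; elim: k i => [|k IHk] i //=.
rewrite !mxE; congr (_ + _); rewrite big_mkord; apply: eq_bigr => j _.
by rewrite !mxE; congr (_ * _); case: eqP => _; rewrite ?mxE IHk.
Qed.

Lemma network_nat_net (sigma : R -> R) (theta : 'cV[R]_(nparams ell))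
    (x : 'cV[R]_dI) (i : 'I_dO) :
  network sigma theta x i 0 =
  nat_net w sigma (nat_weight theta) (nat_bias theta) (coord x) L i.
Proof.
rewrite castmxE ord1; apply: realization_nat_net => j.
by rewrite castmxE ord1 -coordE.
Qed.

End parameters.

(** * Transfer of the local minimum to the wide architecture *)

Theorem proposition2p12 (R : realType) (dI dO : nat)
    (hdI : (0 < dI)%N) (hdO : (0 < dO)%N)
    (a b : R) (hab : a < b)
    (sigma : R -> R)
    (hsigma_bounded : [locally [bounded sigma x | x in [set: R]]])
    (hsigma_meas : measurable_fun [set: R] sigma)
    (mu : {finite_measure set (borel R dI) -> \bar R})
    (f : 'cV[R]_dI -> 'cV[R]_dO)
    (hf : measurable_fun (cube a b : set (borel R dI))
            (f : borel R dI -> borel R dO))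
    (hrisk : forall (L : nat) (ell : architecture dI dO L)
       (theta : 'cV[R]_(nparams ell)), (0 < L)%N ->
       ext_risk sigma a b mu f theta \is a fin_num)
    (alpha beta : R) (halphabeta : alpha < beta)
    (hconst : forall x : R, alpha < x < beta -> sigma x = sigma alpha)
    (L : nat) (hL : (0 < L)%N)
    (ell ell' : architecture dI dO L)
    (hell : forall i : nat, (0 < i < L)%N -> (width ell i <= width ell' i)%N)
    (theta : 'cV[R]_(nparams ell))
    (htheta : local_minimum (risk sigma a b mu f (ell := ell)) theta) :
  exists vartheta : 'cV[R]_(nparams ell'),
    (forall x : 'cV[R]_dI,
       network sigma vartheta x = network sigma theta x) /\
    local_minimum (risk sigma a b mu f (ell := ell')) vartheta.
Proof.
set w := width ell; set w' := width ell'.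
have w0 : w 0%N = w' 0%N by rewrite /w /w' /width !widths_first.
have wL : w L = w' L by rewrite /w /w' /width !widths_last.
have ww' k : (k <= L)%N -> (w k <= w' k)%N.
  case: k => [_|k]; first by rewrite w0.
  by rewrite leq_eqVlt => /orP[/eqP->|kL]; [rewrite wL|exact: hell].
pose W' k i j :=
  if (i < w k)%N && (j < w k.-1)%N then nat_weight theta k i j else 0.
pose B' k i := if (i < w k)%N then nat_bias theta k i else (alpha + beta) / 2.
pose vartheta := mkparams ell' W' B'.
(* For [k = 1] the sum is empty, since both input widths are [dI]. *)
pose foldB (u : 'cV[R]_(nparams ell')) k i := nat_bias u k i +
  (\sum_(w k.-1 <= j < w' k.-1) nat_weight u k i j) * sigma alpha.
pose P (u : 'cV[R]_(nparams ell')) := mkparams ell (nat_weight u) (foldB u).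
have w_le k : (k <= L)%N -> (w k.-1 <= w' k.-1)%N.
  by move=> kL; rewrite ww'// (leq_trans (leq_pred _)).
have vW k i j : (0 < k <= L)%N -> (i < w' k)%N -> (j < w' k.-1)%N ->
    nat_weight vartheta k i j = W' k i j by exact: nat_weight_mkparams.
have vB k i : (0 < k <= L)%N -> (i < w' k)%N -> nat_bias vartheta k i = B' k i.
  exact: nat_bias_mkparams.
have P_vartheta : P vartheta = theta.
  apply: mkparams_eq => [k i j kL iw jw|k i kL iw]; case/andP: (kL) => k0 kL'.
    have iw' := leq_trans iw (ww' _ kL'); have jw' := leq_trans jw (w_le _ kL').
    by rewrite vW// /W' /w iw jw.
  have iw' := leq_trans iw (ww' _ kL').
  (* At [vartheta] the weights leaving surplus neurons vanish, so folding leaves the biases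
     unchanged. *)
  rewrite /foldB vB// /B' /w iw big_nat big1 ?mul0r ?addr0//.
  move=> j /andP[wj jw']; rewrite vW// /W' /w iw/=.
  by rewrite ltnNge wj.
have P_cont : P u @[u --> vartheta] --> theta.
  rewrite -P_vartheta; apply: (@cvg_mkparams _ _ _ _ _ _ (nbhs vartheta)) => [k i j|k i].
    exact: param_cvg.
  apply: cvgD; first exact: param_cvg.
  apply: cvgM; last exact: cvg_cst.
  by apply: cvg_big => [|j _]; [exact: add_continuous|exact: param_cvg].
(* Stated for a single pair [u], [x], to serve both at [vartheta] with any input and near [vartheta]
   with inputs in the cube. *)
have network_P u x :
    (forall k i, (0 < k < L)%N -> (w k <= i < w' k)%N ->
      sigma (nat_net w' sigma (nat_weight u) (nat_bias u) (coord x) k i) =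
      sigma alpha) ->
    network sigma u x = network sigma (P u) x.
  move=> new; apply/colP => i; rewrite !network_nat_net; apply/esym.
  apply: (nat_net_merge w0 ww' _ _ new) => //.
  - by move=> *; apply: nat_weight_mkparams.
  - by move=> *; apply: nat_bias_mkparams.
  - by rewrite /w /width widths_last.
have mid : alpha < (alpha + beta) / 2 < beta by rewrite !midf_lt.
have network_vartheta x : network sigma vartheta x = network sigma theta x.
  (* Incoming weights of surplus neurons are exactly 0 here, so their preactivation is the midpoint
     for every input, even outside the cube. *)
  rewrite -[in RHS]P_vartheta; apply: network_P => -[//|k] i kL /andP[wi iw'].
  have kL' : (0 < k.+1 <= L)%N := ltnW kL.
  rewrite hconst//= vB// /B' ltnNge wi/= big_nat big1 ?addr0//.
  by move=> j jw; rewrite vW// /W' ltnNge wi/= mul0r.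
exists vartheta; split => //.
(* Using [globally] on the cube makes each statement near [G] uniform in [x]. *)
pose G := filter_prod (nbhs vartheta) (globally (cube a b : set 'cV[R]_dI)).
have G_weight k i j :
    nat_weight p.1 k i j @[p --> G] --> nat_weight vartheta k i j.
  apply: (cvg_comp fst (fun u => nat_weight u k i j) cvg_fst).
  exact: param_cvg.
have G_bias k i : nat_bias p.1 k i @[p --> G] --> nat_bias vartheta k i.
  apply: (cvg_comp fst (fun u => nat_bias u k i) cvg_fst).
  exact: param_cvg.
have G_input i : bounded_near (fun p => coord p.2 i) G.
  (* This bounds every element of [[a, b]], and also the default value 0 of [coord] out of range. *)
  apply/bounded_nearP; exists (`|a| + `|b|).
  exists (setT, cube a b); first by split=> //=; exact: filterT.
  move=> [u x] /= [_ xab]; rewrite /coord; case: insubP => [j _ _|_] /=.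
    have /andP[ax xb] := xab j; rewrite ler_norml; apply/andP; split.
      rewrite (le_trans _ ax)// lerNl (le_trans (ler_norm _))// normrN.
      by rewrite lerDl.
    by rewrite (le_trans xb)// (le_trans (ler_norm _))// lerDr.
  by rewrite normr0 addr_ge0.
have new_near : \forall p \near G, forall k, (k < L)%N ->
    forall i, (i < w' k)%N -> (0 < k)%N && (w k <= i)%N ->
    alpha < nat_net w' sigma (nat_weight p.1) (nat_bias p.1) (coord p.2) k i
      < beta.
  (* Only finitely many pairs [k], [i] occur, so it suffices to treat each one separately. *)
  apply: near_forall_ltn => k kL; apply: near_forall_ltn => i iw.
  case: k => [|k] in kL iw *; first exact: nearW.
  have [wi|_] := boolP (w k.+1 <= i)%N; last exact: nearW.
  have kL' : (0 < k.+1 <= L)%N := ltnW kL.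
  have net_mid : nat_net w' sigma (nat_weight p.1) (nat_bias p.1) (coord p.2)
      k.+1 i @[p --> G] --> (alpha + beta) / 2.
    apply: nat_net_cvg_bias => // [k' i' j|k' i'|j jw|].
    - exact: cvg_bounded (G_weight _ _ _).
    - exact: cvg_bounded (G_bias _ _).
    - have := G_weight k.+1 i j.
      by rewrite vW// /W' ltnNge wi.
    - have := G_bias k.+1 i.
      by rewrite vB// /B' ltnNge wi.
  have /andP[amid midb] := mid.
  near=> p => _; apply/andP; split; near: p.
    exact: cvgr_gt net_mid _ amid.
  exact: cvgr_lt net_mid _ midb.
have risk_P : \forall u \near vartheta,
    risk sigma a b mu f u = risk sigma a b mu f (P u).
  (* A set of [G] contains a product [U] times [C] with the cube inside [C], so one neighbourhood
     [U] of [vartheta] serves all inputs. *)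
  case: new_near => -[U C] /= [U_nbhs cubeC] UC.
  apply: filterS U_nbhs => u Uu; congr fine; apply: eq_integral => x.
  rewrite inE => xab; rewrite network_P// => k i /andP[k0 kL] /andP[wi iw'].
  apply: hconst.
  by apply: (UC (u, x)) => //=; [split => //; exact: cubeC|rewrite k0 wi].
have risk_vartheta : risk sigma a b mu f vartheta = risk sigma a b mu f theta.
  by congr fine; apply: eq_integral => x _; rewrite network_vartheta.
(* The risk at [vartheta] is that at [theta], at most that at [P u] by [P_cont] and [htheta], which
   is that at [u]. *)
rewrite /local_minimum risk_vartheta; near=> u.
rewrite (near risk_P u)//; near: u; exact: P_cont htheta.
Unshelve. all: by end_near. Qed.
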